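(* Let $d>2$ and $0\le a\le b\le q$ be integers with $b\neq 0$, and suppose that the code $C:=C(d,a,b)$ belongs to group (G1), i.e. $0<d(q+1)-a-b<q^2-q-2$. Put $a_1:=a$, $a_2:=b$ and let $r$ be the largest $i\in\{1,2\}$ such that $a_i\le d-2+i$ if such an $i$ exists, and $r:=0$ otherwise. If $a\neq 0$, then the minimum distance of the dual code $C^\perp$ is $d$. Moreover, if $\{P_1,\dots,P_d\}\subseteq B$ is the support of a minimum-weight codeword of $C^\perp$, then: (a) if $r=0$, the points $P_1,\dots,P_d$ are collinear; (b) if $r=1$, the points $P_\infty,P_1,\dots,P_d$ are collinear; (c) if $r=2$ and $d>3$, the points $P_1,\dots,P_d$ are collinear; (d) if $r=2$ and $d=3$, then either (d.1) $P_1,\dots,P_d$ are collinear, or (d.2) they lie on the union of the line through $P_0$ and $P_\infty$ and a smooth conic which is tangent to $X$ at both $P_0$ and $P_\infty$, or (d.3) they lie on an irreducible cubic which is tangent to $X$ at both $P_0$ and $P_\infty$. If $a=0$, then the minimum distance of $C^\perp$ is $d+1$ and $r\neq 0$. Moreover, if $\{P_1,\dots,P_{d+1}\}\subseteq B$ is the support of a minimum-weight codeword of $C^\perp$, then: (a) if $r=1$, the points $P_1,\dots,P_{d+1}$ are collinear; (b) if $r=2$, the points $P_0,P_1,\dots,P_{d+1}$ are collinear.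
   Context: Let $q$ be a prime power, $\mathbb{P}^2$ the projective plane over $\mathbb{F}_{q^2}$ with coordinates $(x:y:z)$, and $X\subseteq\mathbb{P}^2$ the Hermitian curve, with affine equation $y^q+y=x^{q+1}$; it is a smooth plane curve of degree $q+1$ with $q^3+1$ $\mathbb{F}_{q^2}$-rational points, and its canonical divisors have degree $q^2-q-2$. Let $P_\infty=(0:1:0)$ and $P_0=(0:0:1)$, both in $X(\mathbb{F}_{q^2})$, and $B:=X(\mathbb{F}_{q^2})\setminus\{P_\infty,P_0\}$. For integers $d>0$ and $0\le a,b\le q$, let $E:=aP_\infty+bP_0$, viewed as a zero-dimensional subscheme of $\mathbb{P}^2$, and let $C(d,a,b)\subseteq\mathbb{F}_{q^2}^{\,|B|}$ be the linear code obtained by evaluating the vector space $H^0(X,\mathcal{O}_X(d)(-E))$ at the points of $B$. Equivalently, one evaluates the homogeneous forms of degree $d$ over $\mathbb{F}_{q^2}$ that vanish on the scheme $E$ at fixed coordinate representatives of the points of $B$; a different choice of representatives multiplies the code coordinatewise by a vector with nonzero entries, which changes neither the minimum distance of the dual code nor the supports of its codewords. $C^\perp$ denotes the dual code, and the support of a codeword is identified with the corresponding subset of $B$. Minimum-weight codewords are nonzero codewords of minimum Hamming weight. *)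

(* Defs.v *)
From HB Require Import structures.
From mathcomp Require Import all_boot all_order all_algebra.
From mathcomp Require Export mpoly.

Set Implicit Arguments.
Unset Strict Implicit.
Unset Printing Implicit Defensive.

Import GRing.Theory.
Local Open Scope ring_scope.

Definition prime_power (q : nat) : Prop :=
  exists p k : nat, [/\ prime p, (0 < k)%N & q = (p ^ k)%N].

Definition ix : 'I_3 := @Ordinal 3 0 isT.
Definition iy : 'I_3 := @Ordinal 3 1 isT.
Definition iz : 'I_3 := @Ordinal 3 2 isT.
Definition iu : 'I_2 := @Ordinal 2 0 isT.
Definition iv : 'I_2 := @Ordinal 2 1 isT.

Section Plane.
Variable F : finFieldType.

(* A rational point of the projective plane is represented by its unique
   coordinate vector whose last nonzero coordinate equals 1. *)
Definition P2 : {set {ffun 'I_3 -> F}} :=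
  [set P : {ffun 'I_3 -> F} | [exists i : 'I_3,
     (P i == 1) && [forall j : 'I_3, (i < j)%N ==> (P j == 0)]]].

Definition point (x y z : F) : {ffun 'I_3 -> F} :=
  [ffun i : 'I_3 => nth 0 [:: x; y; z] i].

Definition Pinf : {ffun 'I_3 -> F} := point 0 1 0.
Definition P0 : {ffun 'I_3 -> F} := point 0 0 1.

Definition plane_curve (n : nat) (g : {mpoly F[3]}) : Prop :=
  g != 0 /\ g \is n.-homog.

Definition collinear (S : {set {ffun 'I_3 -> F}}) : Prop :=
  exists2 l : {mpoly F[3]}, plane_curve 1 l &
    forall P, P \in S -> l.@[P] = 0.

(* Geometric smoothness: the Jacobian criterion at the points of the curve
   over every extension field of F. *)
Definition smooth_curve (g : {mpoly F[3]}) : Prop :=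
  forall (L : fieldType) (iota : {rmorphism F -> L}) (v : 'I_3 -> L),
    (exists i, v i != 0) -> (map_mpoly iota g).@[v] = 0 ->
    exists i, (map_mpoly iota g^`M(i)).@[v] != 0.

(* Irreducibility over F.  For a cubic with two distinct rational points this
   is the same as geometric irreducibility: a cubic irreducible over the finite
   field F but not geometrically is a union of three conjugate lines, which
   have at most one rational point in common. *)
Definition irreducible_curve (g : {mpoly F[3]}) : Prop :=
  (1 < msize g)%N /\
  forall u v : {mpoly F[3]}, g = u * v -> (msize u <= 1)%N \/ (msize v <= 1)%N.

(* Dehomogenization in the affine charts y = 1 and z = 1, whose origins are
   Pinf and P0 respectively. *)
Definition at_Pinf (g : {mpoly F[3]}) : {mpoly F[2]} :=
  g \mPo [tuple 'X_iu; 1; 'X_iv].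
Definition at_P0 (g : {mpoly F[3]}) : {mpoly F[2]} :=
  g \mPo [tuple 'X_iu; 'X_iv; 1].

Definition in_max_ideal_pow (n : nat) (g : {mpoly F[2]}) : Prop :=
  forall m, m \in msupp g -> (n <= mdeg m)%N.

(* [h] is the affine equation of a curve that is smooth at the origin O.  The
   divisor n O of that curve is the subscheme of the plane with ideal
   (h) + m_O^n.  No localization is needed, since this ideal contains m_O^n, so
   that its quotient ring is already local (or zero). *)
Definition vanishes_on_multiple (h : {mpoly F[2]}) (n : nat)
    (g : {mpoly F[2]}) : Prop :=
  exists u r : {mpoly F[2]}, g = u * h + r /\ in_max_ideal_pow n r.

(* The line [l] through the origin is a tangent line of the affine curve [g] at
   the origin, that is, a linear factor of the initial form of [g].  If the
   curve does not pass through the origin, this form is a nonzero constant and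
   there is no such line. *)
Definition tangent_line (l g : {mpoly F[2]}) : Prop :=
  [/\ l != 0, l \is 1.-homog &
    exists m : nat,
      [/\ in_max_ideal_pow m g, pihomog mdeg m g != 0 &
          exists k : {mpoly F[2]}, pihomog mdeg m g = k * l]].

Definition tangent (g h : {mpoly F[2]}) : Prop :=
  exists l, tangent_line l g /\ tangent_line l h.

End Plane.

Arguments Pinf {F}.
Arguments P0 {F}.

Section Hermitian.
Variables (F : finFieldType) (q : nat).

(* The homogenization of y^q + y = x^(q+1). *)
Definition hermitian_form : {mpoly F[3]} :=
  'X_iy ^+ q * 'X_iz + 'X_iy * 'X_iz ^+ q - 'X_ix ^+ q.+1.

Definition hermitian_points : {set {ffun 'I_3 -> F}} :=
  [set P in P2 F | hermitian_form.@[P] == 0].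

Definition B : {set {ffun 'I_3 -> F}} := hermitian_points :\: [set Pinf; P0].

Definition tangent_to_X_at_P0_and_Pinf (g : {mpoly F[3]}) : Prop :=
  tangent (at_P0 g) (at_P0 hermitian_form) /\
  tangent (at_Pinf g) (at_Pinf hermitian_form).

Definition vanishes_on_E (a b : nat) (f : {mpoly F[3]}) : Prop :=
  vanishes_on_multiple (at_Pinf hermitian_form) a (at_Pinf f) /\
  vanishes_on_multiple (at_P0 hermitian_form) b (at_P0 f).

Definition evaluation (f : {mpoly F[3]}) : 'rV[F]_#|B| :=
  \row_(i < #|B|) f.@[enum_val i].

Definition code (d a b : nat) (c : 'rV[F]_#|B|) : Prop :=
  exists f : {mpoly F[3]},
    [/\ f \is d.-homog, vanishes_on_E a b f & c = evaluation f].

Definition word_support (w : 'rV[F]_#|B|) : {set {ffun 'I_3 -> F}} :=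
  [set enum_val i | i : 'I_#|B| & w 0 i != 0].

End Hermitian.

Arguments code F q d a b c : clear implicits.

Section Codes.
Variables (F : finFieldType) (n : nat).

Definition dual (C : 'rV[F]_n -> Prop) (w : 'rV[F]_n) : Prop :=
  forall c, C c -> \sum_i c 0 i * w 0 i = 0.

Definition weight (w : 'rV[F]_n) : nat := #|[set i | w 0 i != 0]|.

Definition min_distance (C : 'rV[F]_n -> Prop) (delta : nat) : Prop :=
  (exists u v, [/\ C u, C v, u != v & weight (u - v) = delta]) /\
  (forall u v, C u -> C v -> u != v -> (delta <= weight (u - v))%N).

Definition min_weight_codeword (C : 'rV[F]_n -> Prop) (w : 'rV[F]_n) : Prop :=
  [/\ C w, w != 0 &
      forall v, C v -> v != 0 -> (weight w <= weight v)%N].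

End Codes.

Definition group_G1 (q d a b : nat) : Prop :=
  (0 < d%:Z * (q%:Z + 1) - a%:Z - b%:Z < q%:Z ^+ 2 - q%:Z - 2)%R.

(* The bigop \max has the value 0 when no index satisfies the condition. *)
Definition r_index (d a b : nat) : nat :=
  (\max_(i <- [:: 1; 2] | nth 0 [:: a; b] i.-1 <= d - 2 + i) i)%N.

(* Main.v *)
Require Import Defs.
From HB Require Import structures.
From mathcomp Require Import all_boot all_order all_algebra.
From mathcomp Require Import finfield.
From mathcomp Require Import mpoly.
From mathcomp Require Import ring zify.

Set Implicit Arguments.
Unset Strict Implicit.

Import GRing.Theory.
Local Open Scope ring_scope.

(** The points of B lie in the chart z = 1 and satisfy y != 0, and the tangent
    lines of X at Pinf and P0 are z = 0 and y = 0, with contact of order q + 1.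
    Since a and b are at most q, a multiple of z satisfies the condition at
    Pinf and a multiple of y the one at P0.  So H^0(O(d)(-E)) contains y z g for
    every form g of degree d - 2, and also y g for every form g of degree d - 1
    when a = 0.  As y and z do not vanish on B, a word of the dual code is also
    orthogonal to all forms of degree n, up to these nonzero factors, with
    n = d - 2 in general and n = d - 1 when a = 0.

    A word cannot be orthogonal to a form that vanishes at all points of its
    support but one.  A product of n lines does exactly this when the support
    has at most n + 1 points ([isolating_form]), or when it has n + 2 points
    that are not collinear, because one line then takes care of two points
    ([chord_or_isolating]).  Hence the weight is at least n + 2, that is d or
    d + 1, and words of weight n + 2 have collinear support
    ([dual_weight_bound]).  For d = 3 and r = 2 this already excludes the conic
    and the cubic: the support is always collinear.

    The line of the support passes through the point O = Pinf or O = P0 when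
    the statement says so ([collinear_with_centre]).  Otherwise the lines
    joining O to the points of the support are distinct, and the product of all
    of them but one isolates a point.  For O = Pinf this product has degree
    d - 1 and multiplicity d - 1 at Pinf, so that y times it belongs to the
    space as soon as a <= d - 1; for O = P0 it has degree and multiplicity d,
    which suffices if b <= d and a = 0.

    Words of weight n + 2 exist on the line x = 0 through P0 and Pinf
    ([dual_word_on_axis]).  It contains q - 1 points (0 : y : 1) of B, which is
    enough by the upper bound defining the group (G1).  On it a form of the
    space restricts to a combination of y, ..., y^(n+1): vanishing at P0 removes
    the constant term and, if a > 0, vanishing at Pinf removes y^d.  So any
    n + 2 points are linearly dependent. *)

(** * Forms in the plane *)

Section PlaneForms.
Variable F : finFieldType.
Implicit Types (f m : {mpoly F[3]}).
Implicit Types (P Q R : {ffun 'I_3 -> F}) (S : {set {ffun 'I_3 -> F}}).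

Lemma ffun3P P x y z : P ix = x -> P iy = y -> P iz = z -> P = point x y z.
Proof.
move=> <- <- <-; apply/ffunP=> -[[|[|[|//]]] lti]; rewrite ffunE /=;
  by congr (P _); apply: val_inj.
Qed.

Definition line (al be ga : F) : {mpoly F[3]} :=
  al *: 'X_ix + be *: 'X_iy + ga *: 'X_iz.

Lemma line_homog al be ga : line al be ga \is 1.-homog.
Proof. by do 2?apply: rpredD; apply: rpredZ; rewrite dhomogX /= mdeg1. Qed.

Lemma meval_line al be ga P :
  (line al be ga).@[P] = al * P ix + be * P iy + ga * P iz.
Proof. by rewrite !mevalD !mevalZ !mevalXU. Qed.

Lemma line_collinear al be ga S :
    [|| al != 0, be != 0 | ga != 0] ->
    {in S, forall P, al * P ix + be * P iy + ga * P iz = 0} ->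
  collinear S.
Proof.
move=> nz lS; exists (line al be ga); last by move=> P /lS; rewrite meval_line.
split; last exact: line_homog.
apply: contraL nz => /eqP l0; rewrite !negb_or !negbK.
have E x y z : al * x + be * y + ga * z = 0.
  have := meval_line al be ga (point x y z).
  by rewrite l0 meval0 !ffunE /= => <-.
move: (E 1 0 0) (E 0 1 0) (E 0 0 1).
by rewrite !mulr0 !mulr1 !addr0 !add0r => -> -> ->; rewrite eqxx.
Qed.

Definition isolates S R (f : {mpoly F[3]}) : Prop :=
  f.@[R] != 0 /\ {in S :\ R, forall Q, f.@[Q] = 0}.

Lemma prod_homog (I : finType) (A : {set I}) (l : I -> {mpoly F[3]}) :
  (forall i, l i \is 1.-homog) -> \prod_(i in A) l i \is #|A|.-homog.
Proof.
move=> hl; rewrite -sum1_card; elim/big_rec2: _ => [|i f n _ hf].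
  exact: dhomog1.
exact: dhomogM.
Qed.

Lemma prod_isolates S R (l : {ffun 'I_3 -> F} -> {mpoly F[3]}) :
    {in S :\ R, forall Q, (l Q).@[R] != 0} ->
    {in S :\ R, forall Q, (l Q).@[Q] = 0} ->
  isolates S R (\prod_(Q in S :\ R) l Q).
Proof.
move=> lR lQ; split; first by rewrite rmorph_prod /=; apply/prodf_neq0.
by move=> Q SQ; rewrite rmorph_prod /= (bigD1 Q) //= lQ ?mul0r.
Qed.

Lemma isolatesM S R m f :
  m.@[R] != 0 -> isolates S R f -> isolates S R (m * f).
Proof.
move=> mR [fR fS]; split=> [|Q /fS]; first by rewrite mevalM mulf_neq0.
by rewrite mevalM => ->; rewrite mulr0.
Qed.

(** Lines avoiding R through the other points; powers of z, which has no zero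
    in the chart z = 1, fill up the degree. *)
Lemma isolating_form n S R :
    {in S, forall P, P iz = 1} -> R \in S -> (#|S| <= n.+1)%N ->
  exists2 f, f \is n.-homog & isolates S R f.
Proof.
move=> z1 SR cS.
pose l Q := if Q ix == R ix then line 0 1 (- Q iy) else line 1 0 (- Q ix).
have hl Q : l Q \is 1.-homog by rewrite /l; case: ifP; rewrite line_homog.
have cT : (#|S :\ R| <= n)%N by move: cS; rewrite (cardsD1 R) SR.
exists ('X_iz ^+ (n - #|S :\ R|) * \prod_(Q in S :\ R) l Q).
  rewrite -[n in n.-homog](subnK cT); apply: dhomogM; last exact: prod_homog.
  rewrite -[X in X.-homog]mul1n; apply: dhomogMn.
  by rewrite dhomogX /= mdeg1.
apply: isolatesM; first by rewrite rmorphXn /= mevalXU z1 // expr1n oner_eq0.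
apply: prod_isolates => Q /setD1P[neQR SQ]; rewrite /l; last first.
  by case: ifP => _; rewrite meval_line z1 //; ring.
case: ifPn => [eqx|nex]; rewrite meval_line (z1 R SR) !mulr1 !mul1r mul0r.
  rewrite add0r subr_eq0; apply: contra neQR => /eqP ey; apply/eqP.
  exact: etrans (ffun3P (eqP eqx) (esym ey) (z1 Q SQ))
                (esym (ffun3P erefl erefl (z1 R SR))).
by rewrite addr0 subr_eq0 eq_sym.
Qed.

Definition chord P Q : {mpoly F[3]} :=
  line (P iy - Q iy) (Q ix - P ix) (P ix * Q iy - P iy * Q ix).

(** If some R in S is off the chord, the chord removes both P and Q, so that
    the other factors have only n - 1 points left to remove. *)
Lemma chord_or_isolating n S P Q :
    {in S, forall P, P iz = 1} -> P \in S -> Q \in S -> P != Q ->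
    (#|S| <= n.+2)%N ->
  {in S, forall R, (chord P Q).@[R] = 0} \/
  (exists R f, [/\ R \in S, f \is n.-homog & isolates S R f]).
Proof.
move=> z1 SP SQ nePQ cS.
case: (boolP [forall R in S, (chord P Q).@[R] == 0]) => [/forall_inP h | ].
  by left=> R /h /eqP.
rewrite negb_forall_in => /exists_inP[R SR chR]; right; exists R.
have chP : (chord P Q).@[P] = 0 by rewrite meval_line z1 //; ring.
have chQ : (chord P Q).@[Q] = 0 by rewrite meval_line z1 //; ring.
have nePR : R != P by apply: contraNneq chR => ->; rewrite chP.
have neQR : R != Q by apply: contraNneq chR => ->; rewrite chQ.
pose T := S :\ P :\ Q.
have TR : R \in T by rewrite !inE neQR nePR.
have cT : (#|T| <= n)%N.
  move: cS; rewrite (cardsD1 P) SP (cardsD1 Q) !inE eq_sym nePQ SQ.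
  by rewrite !add1n !ltnS.
have T1 : (0 < #|T|)%N by rewrite (cardsD1 R) TR.
case: n cT cS => [|n] cT cS; first by move: T1; rewrite ltnNge cT.
have [|f hf [fR fT]] := @isolating_form n T R _ TR cT.
  by move=> U /setD1P[_ /setD1P[_ /z1]].
exists (chord P Q * f); split=> //.
  exact: (dhomogM (line_homog _ _ _) hf).
split; first by rewrite mevalM mulf_neq0.
move=> U /setD1P[neUR SU]; rewrite mevalM.
have [->|neUP] := eqVneq U P; first by rewrite chP mul0r.
have [->|neUQ] := eqVneq U Q; first by rewrite chQ mul0r.
by rewrite fT ?mulr0 // !inE neUR neUQ neUP.
Qed.

Lemma chord_collinear S P Q :
    P iz = 1 -> Q iz = 1 -> P != Q ->
    {in S, forall R, (chord P Q).@[R] = 0} ->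
  collinear S.
Proof.
move=> Pz Qz nePQ hS; apply: line_collinear; last first.
  by move=> R SR; rewrite -meval_line; apply: hS.
rewrite !subr_eq0 -[_ || _]negbK negb_or !negbK negb_or !negbK.
apply: contra nePQ => /and3P[/eqP ey /eqP ex _]; apply/eqP.
exact: etrans (ffun3P erefl ey Pz) (esym (ffun3P ex erefl Qz)).
Qed.

(** A form of collinearity that gives the equation of the line from any two
    points of S; [collinear_with_centre] chooses them. *)
Definition on_every_chord S : Prop :=
  {in S &, forall P Q, P != Q -> {in S, forall R, (chord P Q).@[R] = 0}}.

Lemma on_every_chord_collinear S :
    {in S, forall P, P iz = 1} -> (1 < #|S|)%N -> on_every_chord S ->
  collinear S.
Proof.
move=> z1 /card_gt1P[P [Q [SP SQ nePQ]]] hS.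
exact: chord_collinear (z1 P SP) (z1 Q SQ) nePQ (hS P Q SP SQ nePQ).
Qed.

End PlaneForms.

(** * Forms vanishing on E *)

Section MaxIdealPowers.
Variable F : finFieldType.
Implicit Types (g h : {mpoly F[2]}).

Lemma max_ideal_leq m n g :
  (m <= n)%N -> in_max_ideal_pow n g -> in_max_ideal_pow m g.
Proof. by move=> mn hg k /hg; exact: leq_trans. Qed.

Lemma max_idealN n g : in_max_ideal_pow n g -> in_max_ideal_pow n (- g).
Proof. by move=> hg k; rewrite (perm_mem (msuppN g)) => /hg. Qed.

Lemma max_idealD n g h :
  in_max_ideal_pow n g -> in_max_ideal_pow n h -> in_max_ideal_pow n (g + h).
Proof.
by move=> hg hh k /msuppD_le; rewrite mem_cat => /orP[/hg|/hh].
Qed.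

Lemma max_idealM m n g h :
  in_max_ideal_pow m g -> in_max_ideal_pow n h ->
  in_max_ideal_pow (m + n) (g * h).
Proof.
move=> hg hh k /msuppM_le /allpairsP[[k1 k2] /= [/hg k1m /hh k2n ->]].
by rewrite mdegD leq_add.
Qed.

Lemma max_ideal0 g : in_max_ideal_pow 0 g.
Proof. by []. Qed.

Lemma max_idealMl n g h : in_max_ideal_pow n h -> in_max_ideal_pow n (g * h).
Proof. by move=> hh; rewrite -[n]add0n; apply: max_idealM. Qed.

Lemma max_idealX i : in_max_ideal_pow 1 ('X_i : {mpoly F[2]}).
Proof. by move=> k; rewrite msuppX inE => /eqP ->; rewrite mdeg1. Qed.

Lemma max_ideal_prod (I : finType) (A : {set I}) (l : I -> {mpoly F[2]}) :
    (forall i, in_max_ideal_pow 1 (l i)) ->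
  in_max_ideal_pow #|A| (\prod_(i in A) l i).
Proof.
move=> hl; rewrite -sum1_card; elim/big_rec2: _ => [|i n f _ hf] //.
exact: max_idealM.
Qed.

Lemma max_idealXn i n : in_max_ideal_pow n ('X_i ^+ n : {mpoly F[2]}).
Proof.
elim: n => [|n IH] //; rewrite exprS -add1n; apply: max_idealM IH.
exact: max_idealX.
Qed.

Lemma meval_max_ideal g :
  in_max_ideal_pow 1 g -> g.@[fun=> 0] = 0.
Proof.
move=> hg; rewrite mevalE big1_seq // => m /andP[_ /hg].
rewrite lt0n mdeg_eq0 => nz.
suff /existsP[i mi] : [exists i, m i != 0%N].
  by rewrite (bigD1 i) //= expr0n (negbTE mi) mul0r mulr0.
apply: contraNT nz => /existsPn h; apply/eqP/mnmP=> i.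
by rewrite mnm0E; apply/eqP; rewrite -[_ == _]negbK h.
Qed.

End MaxIdealPowers.

Section VanishingForms.
Variables (F : finFieldType) (q : nat).
Implicit Types (f g : {mpoly F[3]}).

(** The equation of X is symmetric in y and z, so it takes the same form in the
    charts y = 1 and z = 1, in which 'X_iv is the equation of the tangent. *)
Definition hermitian_germ : {mpoly F[2]} :=
  'X_iv + ('X_iv ^+ q - 'X_iu ^+ q.+1).

Lemma at_Pinf_hermitian : at_Pinf (hermitian_form F q) = hermitian_germ.
Proof.
rewrite /at_Pinf /hermitian_form /hermitian_germ rmorphB rmorphD !rmorphM !rmorphXn /=.
by rewrite !comp_mpolyXU /= expr1n !mul1r addrA.
Qed.

Lemma at_P0_hermitian : at_P0 (hermitian_form F q) = hermitian_germ.
Proof.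
rewrite /at_P0 /hermitian_form /hermitian_germ rmorphB rmorphD !rmorphM !rmorphXn /=.
by rewrite !comp_mpolyXU /= expr1n !mulr1 addrA [X in X - _]addrC.
Qed.

(** For n <= q the germ is congruent to 'X_iv modulo the n-th power of the
    maximal ideal. *)
Lemma tangent_vanishes n (k : {mpoly F[2]}) :
  (n <= q)%N -> vanishes_on_multiple hermitian_germ n ('X_iv * k).
Proof.
move=> nq; exists k, (- (k * ('X_iv ^+ q - 'X_iu ^+ q.+1))); split.
  by rewrite /hermitian_germ; ring.
apply/max_idealN/max_idealMl/max_idealD.
  by apply: max_ideal_leq nq _; apply: max_idealXn.
by apply/max_idealN/(max_ideal_leq (leqW nq)); apply: max_idealXn.
Qed.

Lemma max_ideal_vanishes (h k : {mpoly F[2]}) n :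
  in_max_ideal_pow n k -> vanishes_on_multiple h n k.
Proof. by exists 0, k; rewrite mul0r add0r. Qed.

Lemma tangents_vanish_on_E a b f :
    (a <= q)%N -> (b <= q)%N ->
  vanishes_on_E q a b ('X_iy * ('X_iz * f)).
Proof.
move=> aq bq; split.
  rewrite at_Pinf_hermitian /at_Pinf !rmorphM /= !comp_mpolyXU /= mul1r.
  exact: tangent_vanishes.
rewrite at_P0_hermitian /at_P0 rmorphM /= comp_mpolyXU /=.
exact: tangent_vanishes.
Qed.

Lemma max_ideal_vanish_on_E a b f :
    (b <= q)%N -> in_max_ideal_pow a (at_Pinf f) ->
  vanishes_on_E q a b ('X_iy * f).
Proof.
move=> bq hf; split.
  apply: max_ideal_vanishes; rewrite /at_Pinf rmorphM /=.
  exact: max_idealMl.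
rewrite at_P0_hermitian /at_P0 rmorphM /= comp_mpolyXU /=.
exact: tangent_vanishes.
Qed.

Lemma vanishes_at_origin n (g : {mpoly F[2]}) :
    (0 < n)%N -> (0 < q)%N -> vanishes_on_multiple hermitian_germ n g ->
  g.@[fun=> 0] = 0.
Proof.
move=> n0 q0 [u [r [-> hr]]].
rewrite mevalD mevalM /hermitian_germ mevalD mevalB !rmorphXn /= !mevalXU expr0n.
rewrite exprS mul0r (meval_max_ideal (max_ideal_leq n0 hr)).
by rewrite eqn0Ngt q0 /= subrr add0r mulr0 addr0.
Qed.

Lemma vanishes_at_Pinf a b f :
  (0 < a)%N -> (0 < q)%N -> vanishes_on_E q a b f -> f.@[Pinf] = 0.
Proof.
move=> a0 q0 [+ _]; rewrite at_Pinf_hermitian => /(vanishes_at_origin a0 q0).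
rewrite comp_mpoly_meval => <-.
apply: meval_eq => -[[|[|[|//]]] lti]; rewrite ffunE (tnth_nth 0) /=.
- by rewrite mevalXU.
- by rewrite meval1.
- by rewrite mevalXU.
Qed.

Lemma vanishes_at_P0 a b f :
  (0 < b)%N -> (0 < q)%N -> vanishes_on_E q a b f -> f.@[P0] = 0.
Proof.
move=> b0 q0 [_ +]; rewrite at_P0_hermitian => /(vanishes_at_origin b0 q0).
rewrite comp_mpoly_meval => <-.
apply: meval_eq => -[[|[|[|//]]] lti]; rewrite ffunE (tnth_nth 0) /=.
- by rewrite mevalXU.
- by rewrite mevalXU.
- by rewrite meval1.
Qed.

End VanishingForms.

(** * Rational points of the Hermitian curve *)

Section HermitianPoints.
Variables (F : finFieldType) (q : nat).
Hypothesis q_gt0 : (0 < q)%N.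
Implicit Types (P : {ffun 'I_3 -> F}).

Lemma meval_hermitian P :
  (hermitian_form F q).@[P] =
    P iy ^+ q * P iz + P iy * P iz ^+ q - P ix ^+ q.+1.
Proof. by rewrite mevalB mevalD !mevalM !rmorphXn /= !mevalXU. Qed.

Lemma B_affine P : P \in B F q -> P iz = 1 /\ P iy != 0.
Proof.
rewrite inE => /andP[nP /setIdP[]].
move: nP; rewrite !inE negb_or => /andP[nPinf nP0].
move=> /existsP[i /andP[/eqP Pi /forallP Pj]]; rewrite meval_hermitian.
have z0 : 0 ^+ q = 0 :> F by rewrite expr0n eqn0Ngt q_gt0.
move: i Pi Pj => [[|[|[|//]]] lti] Pi Pj.
- rewrite (eqP (Pj iy)) (eqP (Pj iz)).
  have -> : ix = Ordinal lti by exact: val_inj.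
  by rewrite Pi expr1n z0 !mul0r addr0 add0r oppr_eq0 oner_eq0.
- have {}Pi : P iy = 1 by rewrite -Pi; congr (P _); apply: val_inj.
  rewrite (eqP (Pj iz)) Pi z0 !mulr0 addr0 add0r oppr_eq0 expf_eq0 /= => /eqP Px.
  by case/eqP: nPinf; apply: ffun3P => //; apply/eqP/(Pj iz).
have {}Pi : P iz = 1 by rewrite -Pi; congr (P _); apply: val_inj.
move=> H; split=> //; apply: contraNneq nP0 => Py; apply/eqP.
move: H; rewrite Pi Py z0 !mul0r addr0 add0r oppr_eq0 expf_eq0 /= => /eqP Px.
exact: ffun3P.
Qed.

Lemma axis_point_B (y : F) : y != 0 -> y ^+ q + y = 0 -> point 0 y 1 \in B F q.
Proof.
move=> y0 yq; rewrite !inE meval_hermitian !ffunE /=.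
rewrite expr1n !mulr1 exprS mul0r subr0 yq eqxx andbT negb_or; apply/andP; split.
  apply/andP; split; apply/eqP=> /ffunP.
    by move=> /(_ iz); rewrite !ffunE /= => /eqP; rewrite oner_eq0.
  by move=> /(_ iy); rewrite !ffunE /= => /eqP; rewrite (negbTE y0).
apply/existsP; exists iz; rewrite ffunE eqxx /=.
by apply/forallP=> -[[|[|[|//]]] lti].
Qed.

Definition axis_ordinates : {set F} :=
  [set y | (y != 0) && (y ^+ q + y == 0)].

(** The trace y |-> y^q + y maps F into the roots of t^q = t.  So every y of
    nonzero trace is a root of (y^q + y)^(q-1) - 1, which has at most q^2 - q
    roots, and the other elements of F, 0 among them, are at least q. *)
Lemma axis_points_card :
    prime_power q -> #|F| = (q ^ 2)%N ->
  (q.-1 <= #|axis_ordinates|)%N.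
Proof.
move=> [p [k [p_pr k0 qE]]] hF.
have pF : p \in [pchar F].
  by apply: (@card_finPcharP _ _ (k * 2)) => //; rewrite expnM -qE.
have pq : [pchar F].-nat q.
  by rewrite qE pnatX; apply/orP; left; rewrite pnatE.
have q1 : (1 < q)%N by rewrite qE -(exp1n k) ltn_exp2r // prime_gt1.
pose T : {poly F} := 'X^q + 'X.
have sT : size T = q.+1.
  by rewrite size_polyDl size_polyXn // size_polyX ltnS.
have mT : T \is monic.
  by rewrite monicE lead_coefDl ?lead_coefXn // size_polyXn size_polyX.
pose Q := T ^+ q.-1 - 1.
have sQ : size Q = (q * q.-1).+1.
  have sTq : size (T ^+ q.-1) = (q * q.-1).+1.
    rewrite -[q in (q * _)%N]/(q.+1.-1) -sT -size_exp prednK //.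
    by rewrite size_poly_gt0 monic_neq0 // monic_exp.
  by rewrite /Q size_polyDl sTq // size_polyN size_poly1 ltnS muln_gt0 q_gt0 -ltnS prednK.
have Q0 : Q != 0 by rewrite -size_poly_gt0 sQ.
pose Z := [set y : F | y ^+ q + y == 0].
have rZ : all (root Q) (enum (~: Z)).
  apply/allP=> y; rewrite mem_enum !inE => y0.
  rewrite rootE !hornerE subr_eq0 -(inj_eq (mulfI y0)) mulr1.
  rewrite -exprS prednK // exprDn_pchar // -exprM mulnn.
  by rewrite -hF expf_card addrC.
have := max_poly_roots Q0 rZ (enum_uniq _); rewrite -cardE sQ ltnS => cZ.
have cZZ : (#|Z| + #|~: Z| = q ^ 2)%N by rewrite cardsC hF.
have Zq : (q <= #|Z|)%N.
  move: cZ cZZ; rewrite -[q in (q ^ 2)%N](prednK q_gt0).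
  by rewrite -[q in (q * _)%N](prednK q_gt0); nia.
have Z0 : 0 \in Z by rewrite inE expr0n eqn0Ngt q_gt0 addr0.
have -> : axis_ordinates = Z :\ 0.
  by apply/setP=> y; rewrite !inE.
by move: Zq; rewrite (cardsD1 0 Z) Z0 add1n -[X in (X <= _)%N -> _](prednK q_gt0) ltnS.
Qed.

End HermitianPoints.

(** * Supports of dual codewords *)

Section DualWords.
Variables (F : finFieldType) (q d a b : nat).
Hypothesis q_gt0 : (0 < q)%N.
Implicit Types (f g : {mpoly F[3]}) (w : 'rV[F]_#|B F q|).
Implicit Types (O P Q R : {ffun 'I_3 -> F}).
Local Notation dual_code := (dual (code F q d a b)).

Lemma card_word_support w : #|word_support w| = weight w.
Proof. exact/card_imset/enum_val_inj. Qed.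

Lemma mem_word_support w i : (enum_val i \in word_support w) = (w 0 i != 0).
Proof. by rewrite mem_imset ?inE //; apply: enum_val_inj. Qed.

Lemma word_support_B w P : P \in word_support w -> P \in B F q.
Proof. by case/imsetP=> i _ ->; apply: enum_valP. Qed.

Lemma word_support_affine w : {in word_support w, forall P, P iz = 1}.
Proof. by move=> P /word_support_B /(B_affine q_gt0)[]. Qed.

Lemma word_support_neq0 w : w != 0 -> exists P, P \in word_support w.
Proof.
move=> w0; suff /existsP[i wi] : [exists i, w 0 i != 0].
  by exists (enum_val i); rewrite mem_word_support.
apply: contraNT w0 => /existsPn h; apply/eqP/rowP=> i; rewrite mxE.
by apply/eqP; rewrite -[_ == _]negbK h.
Qed.

Lemma dual_not_isolated w R f :
    dual_code w -> R \in word_support w ->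
    f \is d.-homog -> vanishes_on_E q a b f ->
  ~ isolates (word_support w) R f.
Proof.
move=> hw SR hf fE [fR fS].
have /hw : code F q d a b (evaluation q f) by exists f.
case/imsetP: (SR) => i wi RE; rewrite (bigD1 i) //= big1 ?addr0.
  rewrite mxE -RE => /eqP; rewrite mulf_eq0 (negbTE fR) /=.
  by rewrite inE in wi; rewrite (negbTE wi).
move=> j neji; rewrite mxE; have [->|wj] := eqVneq (w 0 j) 0; first by rewrite mulr0.
rewrite fS ?mul0r // in_setD1 RE (inj_eq enum_val_inj) neji.
by rewrite mem_word_support.
Qed.

(** The fixed factor m is yz or y: it makes the forms of degree n vanish on E
    without changing which points of B they vanish at. *)
Lemma dual_weight_bound m e n w :
    m \is e.-homog -> (e + n = d)%N -> {in B F q, forall P, m.@[P] != 0} ->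
    (forall f, vanishes_on_E q a b (m * f)) ->
    dual_code w -> w != 0 ->
  (n.+2 <= weight w)%N /\
  (weight w = n.+2 -> on_every_chord (word_support w)).
Proof.
move=> hm en m0 mE hw w0.
have no_isolating R f : R \in word_support w -> f \is n.-homog ->
    ~ isolates (word_support w) R f.
  move=> SR hf iso; apply: (dual_not_isolated hw SR (f := m * f)) => //.
    by rewrite -en; apply: dhomogM.
  by apply: isolatesM => //; apply/m0/(word_support_B SR).
have [R SR] := word_support_neq0 w0.
split=> [|wn P Q SP SQ nePQ].
  rewrite -card_word_support leqNgt ltnS; apply/negP=> cS.
  by have [f hf /(no_isolating _ _ SR hf)] :=
    isolating_form (@word_support_affine w) SR cS.
rewrite -card_word_support in wn.
have [|[T [f [ST hf iso]]]] := chord_or_isolating (@word_support_affine w)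
  SP SQ nePQ (eq_leq wn); first by [].
by case: (no_isolating _ _ ST hf iso).
Qed.

Hypothesis bq : (b <= q)%N.

Lemma dual_weight_ge w : (a <= q)%N -> (2 < d)%N -> dual_code w -> w != 0 ->
  (d <= weight w)%N /\ (weight w = d -> on_every_chord (word_support w)).
Proof.
move=> aq d_gt2 hw w0; rewrite -[d in (d <= _)%N](subnK (ltnW d_gt2)).
rewrite -[d in _ = d](subnK (ltnW d_gt2)) addn2.
apply: (dual_weight_bound (m := 'X_iy * 'X_iz) (e := 2)) hw w0 => //.
- by apply: (@dhomogM _ _ _ 1 _ 1); rewrite dhomogX /= mdeg1.
- by rewrite subnKC // ltnW.
- by move=> P /(B_affine q_gt0)[Pz Py]; rewrite mevalM !mevalXU Pz mulr1.
by move=> f; rewrite -mulrA; apply: tangents_vanish_on_E.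
Qed.

Lemma dual_weight_gt w : a = 0%N -> (0 < d)%N -> dual_code w -> w != 0 ->
  (d < weight w)%N /\ (weight w = d.+1 -> on_every_chord (word_support w)).
Proof.
move=> a0 d_gt0 hw w0; rewrite -[X in (X < _)%N](prednK d_gt0).
rewrite -[X in _ = X.+1](prednK d_gt0).
apply: (dual_weight_bound (m := 'X_iy) (e := 1)) hw w0 => //.
- by rewrite dhomogX /= mdeg1.
- by rewrite add1n prednK.
- by move=> P /(B_affine q_gt0)[Pz Py]; rewrite mevalXU.
by move=> f; apply: max_ideal_vanish_on_E => //; rewrite a0; apply: max_ideal0.
Qed.

(** Here [l Q] is the line joining O to Q.  If it is the same for two points of
    the support, the chord through them, hence the line of the support, passes
    through O; otherwise the product of the other lines isolates a point. *)
Lemma collinear_with_centre m e w O (l : {ffun 'I_3 -> F} -> {mpoly F[3]}) :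
    m \is e.-homog -> (e + (weight w).-1 = d)%N ->
    {in B F q, forall P, m.@[P] != 0} ->
    (forall Q, l Q \is 1.-homog) -> (forall Q, Q iz = 1 -> (l Q).@[Q] = 0) ->
    {in word_support w &, forall P Q, (l Q).@[P] = 0 -> (chord P Q).@[O] = 0} ->
    (forall R, R \in word_support w ->
       vanishes_on_E q a b (m * \prod_(Q in word_support w :\ R) l Q)) ->
    dual_code w -> w != 0 ->
    on_every_chord (word_support w) ->
  collinear (O |: word_support w).
Proof.
move=> hm em m0 hl lQ lO mE hw w0 hchord.
have z1 := @word_support_affine w.
case: (boolP [exists P in word_support w, exists Q in word_support w,
                (P != Q) && ((l Q).@[P] == 0)]).
  case/exists_inP=> P SP /exists_inP[Q SQ /andP[nePQ /eqP lQP]].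
  apply: (chord_collinear (z1 _ SP) (z1 _ SQ) nePQ) => R.
  by case/setU1P=> [->|SR]; [apply: lO | apply: hchord].
rewrite negb_exists_in => /forall_inP h; have [R SR] := word_support_neq0 w0.
case: (dual_not_isolated hw SR (f := m * \prod_(Q in word_support w :\ R) l Q)).
- rewrite -em; apply: dhomogM => //.
  have -> : (weight w).-1 = #|word_support w :\ R|.
    by rewrite -card_word_support (cardsD1 R) SR.
  exact: prod_homog.
- exact: mE.
apply: isolatesM; first exact/m0/(word_support_B SR).
apply: prod_isolates => Q /setD1P[neQR SQ]; last exact/lQ/z1.
have := h R SR; rewrite negb_exists_in => /forall_inP /(_ Q SQ).
by rewrite negb_and eq_sym neQR.
Qed.

Lemma collinear_with_Pinf w :
    (0 < d)%N -> (a <= d.-1)%N -> dual_code w -> w != 0 -> weight w = d ->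
    on_every_chord (word_support w) ->
  collinear (Pinf |: word_support w).
Proof.
move=> d0 ad hw w0 wd.
apply: (collinear_with_centre (m := 'X_iy) (e := 1)
          (l := fun Q => line 1 0 (- Q ix))) => //.
- by rewrite dhomogX /= mdeg1.
- by rewrite wd add1n prednK.
- by move=> P /(B_affine q_gt0)[_]; rewrite mevalXU.
- by move=> Q; apply: line_homog.
- by move=> Q Qz; rewrite meval_line Qz; ring.
- move=> P Q /word_support_affine Pz _; rewrite !meval_line Pz !ffunE /=.
  by move/eqP; rewrite mul1r mul0r addr0 mulr1 subr_eq0 => /eqP ->; ring.
move=> R SR; apply: max_ideal_vanish_on_E => //.
apply: (@max_ideal_leq _ _ #|word_support w :\ R|).
  by move: ad; rewrite -wd -card_word_support (cardsD1 R) SR.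
rewrite /at_Pinf rmorph_prod /=; apply: max_ideal_prod => Q.
rewrite /line !comp_mpolyD !comp_mpolyZ !comp_mpolyXU /= scale0r addr0.
by apply: max_idealD; rewrite -mul_mpolyC; apply/max_idealMl/max_idealX.
Qed.

Lemma collinear_with_P0 w :
    a = 0%N -> (b <= d)%N -> dual_code w -> w != 0 -> weight w = d.+1 ->
    on_every_chord (word_support w) ->
  collinear (P0 |: word_support w).
Proof.
move=> a0 bd hw w0 wd.
apply: (collinear_with_centre (m := 1) (e := 0)
          (l := fun Q => line (Q iy) (- Q ix) 0)) => //.
- exact: dhomog1.
- by rewrite wd.
- by move=> P _; rewrite meval1 oner_eq0.
- by move=> Q; apply: line_homog.
- by move=> Q _; rewrite meval_line; ring.
- by move=> P Q _ _; rewrite !meval_line !ffunE /= => E; rewrite -[RHS]E; ring.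
move=> R SR; rewrite mul1r; split; apply: max_ideal_vanishes.
  by rewrite a0; apply: max_ideal0.
apply: (@max_ideal_leq _ _ #|word_support w :\ R|).
  by move: bd; rewrite -ltnS -wd -card_word_support (cardsD1 R) SR.
rewrite /at_P0 rmorph_prod /=; apply: max_ideal_prod => Q.
rewrite /line !comp_mpolyD !comp_mpolyZ !comp_mpolyXU /= scale0r addr0.
by apply: max_idealD; rewrite -mul_mpolyC; apply/max_idealMl/max_idealX.
Qed.

End DualWords.

(** * Codewords on the line through the two points of E *)

Section AxisWords.
Variables (F : finFieldType) (q d a b : nat).
Implicit Types (f : {mpoly F[3]}).
Local Notation dual_code := (dual (code F q d a b)).

(** The only monomial of degree d that does not vanish at the i-th coordinate
    point is the pure power of the i-th variable. *)
Lemma meval_coordinate_point f (i : 'I_3) (P : 'I_3 -> F) m :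
    f \is d.-homog -> P i = 1 -> (forall j, j != i -> P j = 0) ->
    m \in msupp f -> (forall j, j != i -> m j = 0%N) ->
  f.@[P] != 0.
Proof.
move=> hf Pi Pj fm mj.
have degE (m' : 'X_{1..3}) : (forall j, j != i -> m' j = 0%N) -> mdeg m' = m' i.
  by move=> h; rewrite mdegE (bigD1 i) //= big1 ?addn0.
rewrite mevalE (bigD1_seq m) //= ?msupp_uniq // [X in _ * X]big1 ?mulr1; last first.
  by move=> j _; have [->|/mj ->] := eqVneq j i; rewrite ?expr0 // Pi expr1n.
rewrite big1_seq ?addr0 ?mcoeff_eq0 ?fm // => m' /andP[nem fm'].
suff /existsP[j /andP[ji m'j]] : [exists j : 'I_3, (j != i) && (m' j != 0%N)].
  by rewrite (bigD1 j) //= Pj // expr0n (negbTE m'j) mul0r mulr0.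
apply: contraNT nem => /existsPn h; apply/eqP/mnmP=> j.
have h' k : k != i -> m' k = 0%N.
  by move=> ki; have := h k; rewrite ki /= negbK => /eqP.
have [->|ji] := eqVneq j i; last by rewrite (mj j ji) (h' j ji).
by rewrite -(degE m' h') -(degE m mj) !(dhomog_mf hf).
Qed.

(** A form vanishing on E vanishes at P0, so z^d does not occur in it; if a is
    positive it vanishes at Pinf, and y^d does not occur either. *)
Lemma axis_exponent f m :
    (0 < q)%N -> (0 < b)%N ->
    f \is d.-homog -> vanishes_on_E q a b f -> m \in msupp f -> m ix = 0%N ->
  (0 < m iy <= d - (a != 0))%N.
Proof.
move=> q_gt0 b_gt0 hf fE fm mx.
have md : (m iy + m iz = d)%N.
  have := dhomog_mf hf fm; rewrite /= mdegE 3!big_ord_recl big_ord0 addn0 => <-.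
  have -> : ord0 = ix by exact: val_inj.
  by rewrite mx add0n; congr (m _ + m _)%N; apply: val_inj.
have pure i (P : {ffun 'I_3 -> F}) : P i = 1 -> (forall j, j != i -> P j = 0) ->
    f.@[P] = 0 -> exists2 j, j != i & m j != 0%N.
  move=> Pi Pj fP; case: (boolP [exists j : 'I_3, (j != i) && (m j != 0%N)]).
    by case/existsP=> j /andP[]; exists j.
  move/existsPn=> h.
  suff : f.@[P] != 0 by rewrite fP eqxx.
  apply: meval_coordinate_point hf Pi Pj fm _ => j ji.
  by have := h j; rewrite ji /= negbK => /eqP.
have my0 : (0 < m iy)%N.
  have [||[[|[|[|//]]] lti] //] := pure iz P0 _ _ (vanishes_at_P0 b_gt0 q_gt0 fE).
  - by rewrite ffunE.
  - by move=> [[|[|[|//]]] lti] //; rewrite ffunE.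
  - by have -> : Ordinal lti = ix by [exact: val_inj]; rewrite mx.
  - by have -> : Ordinal lti = iy by [exact: val_inj]; rewrite lt0n.
rewrite my0 /=; have [a0|a0] := eqVneq a 0%N; first by rewrite subn0 -md leq_addr.
suff : (0 < m iz)%N by rewrite -md; lia.
rewrite -lt0n in a0.
have [||[[|[|[|//]]] lti] //] := pure iy Pinf _ _ (vanishes_at_Pinf a0 q_gt0 fE).
- by rewrite ffunE.
- by move=> [[|[|[|//]]] lti] //; rewrite ffunE.
- by have -> : Ordinal lti = ix by [exact: val_inj]; rewrite mx.
- by have -> : Ordinal lti = iz by [exact: val_inj]; rewrite lt0n.
Qed.

(** On the line x = 0 the code is spanned by n powers of y, so that any n + 1
    of its points carry a linear relation. *)
Lemma dual_word_on_axis n :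
    (n.+1 <= #|axis_ordinates F q|)%N ->
    (forall f m, f \is d.-homog -> vanishes_on_E q a b f -> m \in msupp f ->
       m ix = 0%N -> (0 < m iy <= n)%N) ->
  exists w, [/\ dual_code w, w != 0 & (weight w <= n.+1)%N].
Proof.
move=> cY hn; set Y := axis_ordinates F q in cY.
pose y (j : 'I_n.+1) := nth 0 (enum Y) j.
have ylt (j : 'I_n.+1) : (j < size (enum Y))%N.
  by rewrite -cardE; apply: leq_trans cY.
have yY j : y j \in Y by rewrite -mem_enum; apply: mem_nth.
have yinj : injective y.
  move=> i j /eqP; rewrite nth_uniq ?enum_uniq // => /eqP; exact: val_inj.
have yB j : point 0 (y j) 1 \in B F q.
  by have := yY j; rewrite inE => /andP[y0 /eqP yq]; apply: axis_point_B.
pose k j := enum_rank_in (yB ord0) (point 0 (y j) 1).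
have kE j : enum_val (k j) = point 0 (y j) 1 by rewrite enum_rankK_in.
have kinj : injective k.
  move=> i j /(congr1 enum_val); rewrite !kE => /ffunP/(_ iy).
  by rewrite !ffunE /=; apply: yinj.
pose M := \matrix_(j < n.+1, e < n) y j ^+ e.+1.
have : kermx M != 0.
  by rewrite -mxrank_eq0 mxrank_ker subn_eq0 -ltnNge ltnS rank_leq_col.
case/rowV0Pn=> u /sub_kermxP uM u0.
pose w : 'rV[F]_#|B F q| := \row_i \sum_(j | k j == i) u 0 j.
have wk j : w 0 (k j) = u 0 j.
  by rewrite mxE (eq_bigl (pred1 j)) ?big_pred1_eq // => i; rewrite (inj_eq kinj).
exists w; split.
- move=> c [f [hf fE ->]].
  have -> : \sum_i evaluation q f 0 i * w 0 i
            = \sum_j f.@[point 0 (y j) 1] * u 0 j.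
    (* The word is zero outside the image of the injection k. *)
    rewrite (bigID (fun i => [exists j, k j == i])) /= [X in _ + X]big1 ?addr0.
      rewrite (reindex_onto k (fun i => odflt ord0 [pick j | k j == i])) /=.
        apply: eq_big => [j|j _]; last by rewrite mxE kE wk.
        case: pickP => [j' /eqP/kinj -> /=|/(_ j)]; last by rewrite eqxx.
        by rewrite eqxx andbT; apply/existsP; exists j.
      move=> i /existsP[j /eqP ji]; case: pickP => [j' /eqP //|/(_ j)].
      by rewrite ji eqxx.
    move=> i /existsPn h; rewrite [w _ _]mxE big_pred0 ?mulr0 // => j.
    exact/negbTE.
  under eq_bigr => j _ do rewrite mevalE mulr_suml.
  rewrite exchange_big big1_seq //= => m fm.
  have [mx|mx] := eqVneq (m ix) 0%N; last first.
    rewrite big1 // => j _; rewrite (bigD1 ix) //= ffunE /= expr0n (negbTE mx).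
    by rewrite mul0r mulr0 mul0r.
  have /andP[my0 myn] := hn f m hf fE fm mx.
  have my : ((m iy).-1 < n)%N by rewrite prednK.
  have := congr1 (fun A : 'rV[F]_n => A 0 (Ordinal my)) uM.
  rewrite !mxE => uMj; rewrite -[RHS](mulr0 f@_m) -[in RHS]uMj mulr_sumr.
  apply: eq_bigr => j _; rewrite -mulrA; congr (_ * _); rewrite mulrC !mxE /=.
  rewrite prednK //; congr (_ * _).
  rewrite (bigD1 ix) //= (bigD1 iy) //= big1 ?mulr1 => [|[[|[|[|//]]] lti]] //.
    by rewrite !ffunE /= mx expr0 mul1r.
  by rewrite ffunE /= expr1n.
- apply: contraNneq u0 => wz; apply/eqP/rowP=> j.
  by rewrite -wk wz !mxE.
rewrite /weight -[n.+1]card_ord -[X in (_ <= X)%N](card_imset _ kinj).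
apply/subset_leq_card/subsetP=> i; rewrite inE mxE => wi.
case: (boolP [exists j, k j == i]) => [/existsP[j /eqP <-]|/existsPn h].
  exact: imset_f.
by case/eqP: wi; apply: big_pred0 => j; apply/negbTE.
Qed.

End AxisWords.

(** * The minimum distance *)

Lemma min_distance_dual (F : finFieldType) n (C : 'rV[F]_n -> Prop) delta :
    (forall w, dual C w -> w != 0 -> (delta <= weight w)%N) ->
    (exists w, [/\ dual C w, w != 0 & (weight w <= delta)%N]) ->
  min_distance (dual C) delta /\
  (forall w, min_weight_codeword (dual C) w -> weight w = delta).
Proof.
move=> lb [w [hw w0 wle]].
have wd : weight w = delta by apply/eqP; rewrite eqn_leq wle lb.
split; last first.
  move=> v [hv v0 vmin]; apply/eqP; rewrite eqn_leq lb // andbT -wd.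
  exact: vmin.
split.
  exists w, 0; split=> //; last by rewrite subr0.
  by move=> c _; rewrite big1 // => i _; rewrite mxE mulr0.
move=> u v hu hv neuv; apply: lb; last by rewrite subr_eq0.
move=> c hc; under eq_bigr => i _ do rewrite !mxE mulrBr.
by rewrite sumrB hu // hv // subrr.
Qed.

Lemma degree_lt_q (q d a b : nat) :
  (a <= b)%N -> (b <= q)%N -> group_G1 q d a b -> (d < q)%N.
Proof. by rewrite /group_G1; nia. Qed.

Lemma degree_lt_pred_q (q d b : nat) :
  (b <= q)%N -> group_G1 q d 0 b -> (d.+1 < q)%N.
Proof. by rewrite /group_G1; nia. Qed.

Lemma r_indexE (d a b : nat) : (2 < d)%N ->
  r_index d a b =
  if (b <= d)%N then 2 else if (a <= d.-1)%N then 1 else 0.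
Proof.
move=> d_gt2; rewrite /r_index !big_cons big_nil (_ : d - 2 + 1 = d.-1)%N; last by lia.
rewrite (_ : d - 2 + 2 = d)%N /=; last by lia.
by case: ifP; case: ifP.
Qed.

Theorem theorem19 (q : nat) (F : finFieldType) (d a b : nat)
  (hq : prime_power q) (hF : #|F| = (q ^ 2)%N)
  (hd : (2 < d)%N) (hab : (a <= b)%N) (hbq : (b <= q)%N) (hb : b <> 0%N)
  (hG1 : group_G1 q d a b) :
  (a <> 0%N ->
     min_distance (dual (code F q d a b)) d /\
     (forall w : 'rV[F]_#|B F q|,
        min_weight_codeword (dual (code F q d a b)) w ->
        [/\ r_index d a b = 0%N -> collinear (word_support w),
            r_index d a b = 1%N -> collinear (Pinf |: word_support w),
            r_index d a b = 2%N -> (3 < d)%N -> collinear (word_support w) &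
            r_index d a b = 2%N -> d = 3%N ->
            [\/ collinear (word_support w),
                exists l g : {mpoly F[3]},
                  [/\ plane_curve 1 l /\ (l.@[P0] = 0 /\ l.@[Pinf] = 0),
                      plane_curve 2 g /\ smooth_curve g,
                      tangent_to_X_at_P0_and_Pinf q g &
                      forall P, P \in word_support w -> l.@[P] = 0 \/ g.@[P] = 0] |
                exists g : {mpoly F[3]},
                  [/\ plane_curve 3 g, irreducible_curve g,
                      tangent_to_X_at_P0_and_Pinf q g &
                      forall P, P \in word_support w -> g.@[P] = 0]]])) /\
  (a = 0%N ->
     min_distance (dual (code F q d a b)) d.+1 /\
     r_index d a b <> 0%N /\
     (forall w : 'rV[F]_#|B F q|,
        min_weight_codeword (dual (code F q d a b)) w ->
        (r_index d a b = 1%N -> collinear (word_support w)) /\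
        (r_index d a b = 2%N -> collinear (P0 |: word_support w)))).
Proof.
have b0 : (0 < b)%N by rewrite lt0n; apply/eqP.
have q0 : (0 < q)%N by exact: leq_trans b0 hbq.
have d0 : (0 < d)%N by exact: ltn_trans hd.
have aq : (a <= q)%N by exact: leq_trans hab hbq.
have cY := axis_points_card q0 hq hF.
split=> [a0|a0].
  have /eqP/negbTE a0' := a0.
  have [||hmin hmw] := @min_distance_dual F _ (code F q d a b) d.
  - by move=> w hw w0; have [] := dual_weight_ge q0 hbq aq hd hw w0.
  - have := @dual_word_on_axis F q d a b d.-1.
    rewrite prednK //; apply.
      apply: leq_trans cY.
      by have := degree_lt_q hab hbq hG1; lia.
    move=> f m hf fE fm mx.
    by have := axis_exponent q0 b0 hf fE fm mx; rewrite a0' subn1.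
  split=> // w mw; have wd := hmw w mw; case: mw => hw w0 _.
  have [_ /(_ wd) hchord] := dual_weight_ge q0 hbq aq hd hw w0.
  have hcol : collinear (word_support w).
    apply: (on_every_chord_collinear (@word_support_affine F q q0 w) _ hchord).
    by rewrite card_word_support wd ltnW.
  split=> //; last by move=> _ _; constructor 1.
  rewrite r_indexE //; case: ifP => // _; case: ifP => // ad _.
  exact: (collinear_with_Pinf q0 hbq d0 ad hw w0 wd hchord).
have [||hmin hmw] := @min_distance_dual F _ (code F q d a b) d.+1.
- by move=> w hw w0; have [] := dual_weight_gt q0 hbq a0 d0 hw w0.
- apply: dual_word_on_axis => //.
    apply: leq_trans cY.
    by rewrite a0 in hG1; have := degree_lt_pred_q hbq hG1; lia.
  move=> f m hf fE fm mx.
  by have := axis_exponent q0 b0 hf fE fm mx; rewrite a0 eqxx subn0.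
split=> //; split; first by rewrite r_indexE // a0 leq0n; case: ifP.
move=> w mw; have wd := hmw w mw; case: mw => hw w0 _.
have [_ /(_ wd) hchord] := dual_weight_gt q0 hbq a0 d0 hw w0.
split=> [_|].
  apply: (on_every_chord_collinear (@word_support_affine F q q0 w) _ hchord).
  by rewrite card_word_support wd ltnS.
rewrite r_indexE //; case: ifP => [bd _|_]; last by case: ifP.
exact: (collinear_with_P0 q0 a0 bd hw w0 wd hchord).
Qed.
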